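(* Let $0<\alpha<1$ and let $n\in\mathbb{N}$ satisfy $n^{1-\alpha}>2$. Let $f\in C_B(\mathbb{R})$. Then for every $x\in\mathbb{R}$ $$\left|A_n(f)(x)-f(x)\right|\le \omega\!\left(f,\frac{1}{n^{\alpha}}\right)+\frac{2\left(q+\frac1q\right)\|f\|_\infty}{B^{\beta(n^{1-\alpha}-1)}}=:T,$$ and $$\|A_n(f)-f\|_\infty\le T.$$ Furthermore, if $f\in C_{UB}(\mathbb{R})$, then $\lim_{n\to\infty}A_n(f)=f$ pointwise and uniformly on $\mathbb{R}$.
   Context: Fix real parameters $q>0$, $\beta>0$, $B>1$; $\mathbb{N}=\{1,2,3,\dots\}$. For $x\in\mathbb{R}$ and any $p>0$ put $$\nu_{p,\beta}(x)=\frac{1}{1+pB^{-\beta x}},\qquad G_{p,\beta}(x)=\tfrac12\big(\nu_{p,\beta}(x+1)-\nu_{p,\beta}(x-1)\big),\qquad \Psi(x)=\tfrac12\big(G_{q,\beta}(x)+G_{1/q,\beta}(x)\big).$$ $C_B(\mathbb{R})$ is the set of continuous bounded functions $f:\mathbb{R}\to\mathbb{R}$; $C_{UB}(\mathbb{R})$ is the set of uniformly continuous bounded functions on $\mathbb{R}$; $\|\cdot\|_\infty$ is the supremum norm on $\mathbb{R}$. The modulus of continuity is $\omega(f,\theta)=\sup\{|f(x)-f(y)|: x,y\in\mathbb{R},\ |x-y|\le\theta\}$ for $\theta>0$. For $n\in\mathbb{N}$ the operator $A_n$ is $$A_n(f)(x)=\int_{-\infty}^{\infty} f\!\left(\frac{v}{n}\right)\Psi(nx-v)\,dv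 .$$ *)

(* Defs.v *)
From HB Require Import structures.
From mathcomp Require Import all_boot all_order all_algebra.
From mathcomp Require Import all_classical all_reals all_analysis.

Set Implicit Arguments.
Unset Strict Implicit.
Unset Printing Implicit Defensive.

Import Order.TTheory GRing.Theory Num.Theory.
Import numFieldNormedType.Exports.

Local Open Scope classical_set_scope.
Local Open Scope ring_scope.

Definition nu (R : realType) (B p beta x : R) : R :=
  (1 + p * B `^ (- (beta * x)))^-1.

Definition G (R : realType) (B p beta x : R) : R :=
  2^-1 * (nu B p beta (x + 1) - nu B p beta (x - 1)).

Definition Psi (R : realType) (B q beta x : R) : R :=
  2^-1 * (G B q beta x + G B q^-1 beta x).

(* [Rintegral] is total, but its default value is never reached on the intended
   domain: for f continuous and bounded the integrand is Lebesgue integrable,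
   because Psi is continuous and decays exponentially, so this is also the
   absolutely convergent improper Riemann integral. *)
Definition A (R : realType) (B q beta : R) (n : nat) (f : R -> R) (x : R) : R :=
  (\int[lebesgue_measure]_(v in [set: R])
     (f (v / n%:R) * Psi B q beta (n%:R * x - v)))%R.

Definition CB (R : realType) (f : R -> R) : Prop :=
  continuous f /\ bounded_fun f.

Definition CUB (R : realType) (f : R -> R) : Prop :=
  unif_continuous f /\ bounded_fun f.

(* The suprema below are taken in the extended reals, so that they are genuine
   suprema even when the set is unbounded (the real-valued [sup] would be 0
   there). They are finite when f is bounded. *)
Definition supnorm (R : realType) (f : R -> R) : \bar R :=
  ereal_sup [set (`|f x|)%:E | x in [set: R]].

Definition omega (R : realType) (f : R -> R) (theta : R) : \bar R :=
  ereal_sup [set (`|f z.1 - f z.2|)%:E | z in [set z : R * R | `|z.1 - z.2| <= theta]].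

(* Main.v *)
(** With c = beta ln B, the function nu_p has the primitive
    c^-1 ln (e^(c x) + p), so Psi has an explicit primitive Phi, with
    0 <= Phi x <= (q + 1/q)/2 e^(c (x + 1)) because ln y <= y - 1, and
    1 - Phi x = Phi (- x). Hence Psi has total mass 1, and its mass outside
    [-m, m] is 2 Phi (- m) <= (q + 1/q) e^(- c (m - 1)). Splitting
    A_n f x - f x = \int (f (v / n) - f x) Psi (n x - v) dv according to whether
    |v / n - x| <= n^(-alpha) or not bounds the first part by the modulus of
    continuity and the second by 2 |f|_oo times the mass beyond
    m = n^(1 - alpha). With a fixed radius d in place of n^(-alpha), the same
    estimate gives uniform convergence. *)

Require Import Defs.
From HB Require Import structures.
From mathcomp Require Import all_boot all_order all_algebra.
From mathcomp Require Import all_classical all_reals all_analysis.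
From mathcomp Require Import measurable_realfun ring lra.

Set Implicit Arguments.
Unset Strict Implicit.
Unset Printing Implicit Defensive.

Import Order.TTheory GRing.Theory Num.Theory.
Import numFieldNormedType.Exports.

Local Open Scope classical_set_scope.
Local Open Scope ring_scope.

(** * Elementary estimates for the exponential and the logarithm *)

Lemma onem_expRN_le (R : realType) (x : R) : 1 - expR (- x) <= x.
Proof. by rewrite lerBlDr -lerBlDl expR_ge1Dx. Qed.

Lemma ln_le_subr1 (R : realType) (x : R) : 0 < x -> ln x <= x - 1.
Proof.
by move=> x0; have := @le_ln1Dx R (x - 1); rewrite subrKC; apply; lra.
Qed.

Lemma cvg_expRNM (R : realType) (a : R) : 0 < a ->
  expR (- (a * x)) @[x --> +oo] --> 0.
Proof.
move=> a0.
apply: (@cvg_comp _ _ _ (fun x => a * x) (fun x => expR (- x)) +oo +oo).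
  exact: gt0_cvgMry.
exact: cvgr_expR.
Qed.

(** * Explicit primitives of [nu] and [G], with [c] standing for beta ln B *)

Section Primitive.
Context {R : realType}.
Variables (c : R) (c_gt0 : 0 < c).

Definition nu_primitive (p x : R) : R := c^-1 * ln (expR (c * x) + p).

(** The limit c^-1 ln p of [nu_primitive] at -oo cancels in the difference, so for p > 0 this is the
    primitive of [G] that tends to 0 at -oo. *)
Definition G_primitive (p x : R) : R :=
  2^-1 * (nu_primitive p (x + 1) - nu_primitive p (x - 1)).

Lemma is_derive_nu_primitive (p x : R) : 0 < p ->
  is_derive x 1 (nu_primitive p) (1 + p * expR (- (c * x)))^-1.
Proof.
move=> p0.
have e0 : 0 < expR (c * x) + p by rewrite addr_gt0// expR_gt0.
have dl := is_derive1_ln e0.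
have : is_derive x 1 (nu_primitive p)
   (c^-1 *: ((expR (c * x) + p)^-1 * (expR (c * x) * (c *: 1) + 0))).
  exact: is_deriveZ.
move=> /is_derive_eq; apply; rewrite /GRing.scale/= mulr1 addr0 expRN.
have := expR_gt0 (c * x).
by move=> h; field; rewrite !gt_eqF//= addr_gt0.
Qed.

(** As the logarithm of a single quotient, the primitive has a visible sign and can be bounded by ln
    y <= y - 1. *)
Lemma G_primitiveE (p x : R) : 0 < p ->
  G_primitive p x =
  (2 * c)^-1 * ln ((expR (c * (x + 1)) + p) / (expR (c * (x - 1)) + p)).
Proof.
move=> p0; rewrite ln_div ?posrE ?addr_gt0 ?expR_gt0//.
by rewrite /G_primitive /nu_primitive -mulrBr mulrA invfM.
Qed.

Lemma G_primitive_ge0 (p x : R) : 0 < p -> 0 <= G_primitive p x.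
Proof.
move=> p0; rewrite G_primitiveE// mulr_ge0 ?invr_ge0 ?mulr_ge0 ?(ltW c_gt0)//.
rewrite ln_ge0// ler_pdivlMr ?addr_gt0 ?expR_gt0// mul1r lerD2r ler_expR.
by rewrite ler_pM2l//; lra.
Qed.

(** With y = (a + p) / (b + p), ln y <= y - 1 = (a - b) / (b + p). Here a - b = a (1 - e^(-2c)) <= 2
    c a, which absorbs the factor (2c)^-1, and b + p >= p. *)
Lemma G_primitive_le (p x : R) : 0 < p ->
  G_primitive p x <= p^-1 * expR (c * (x + 1)).
Proof.
move=> p0; rewrite G_primitiveE// mulrC ler_pdivrMr ?mulr_gt0//.
set a := expR (c * (x + 1)); set b := expR (c * (x - 1)).
have a0 : 0 < a by exact: expR_gt0.
have b0 : 0 < b by exact: expR_gt0.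
have bE : b = a * expR (- (2 * c)) by rewrite -expRD; congr expR; ring.
apply: (le_trans (ln_le_subr1 _)); first by rewrite divr_gt0// addr_gt0.
have -> : (a + p) / (b + p) - 1 = (a - b) / (b + p).
  by field; rewrite gt_eqF// addr_gt0.
rewrite ler_pdivrMr ?addr_gt0//.
apply: (@le_trans _ _ (a * (2 * c))).
  by rewrite bE -{1}(mulr1 a) -mulrBr ler_pM2l// onem_expRN_le.
have -> : p^-1 * a * (2 * c) * (b + p) = a * (2 * c) * (1 + b / p).
  by field; rewrite gt_eqF.
by rewrite ler_pMr ?mulr_gt0// lerDl divr_ge0// ltW.
Qed.

(** Writing 1 = (2c)^-1 ln (e^(2c)) with e^(2c) = a / b, both sides become logarithms of the same
    quotient a (b + p) / (b (a + p)). *)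
Lemma G_primitive_onem (p x : R) : 0 < p ->
  1 - G_primitive p x = G_primitive p^-1 (- x).
Proof.
move=> p0; rewrite !G_primitiveE ?invr_gt0//.
apply: (@mulfI _ (2 * c)); first by rewrite gt_eqF// mulr_gt0.
rewrite mulrBr !mulrA divff ?gt_eqF ?mulr_gt0// !mul1r mulr1 -[X in X - _]expRK.
have a0 : 0 < expR (c * (x + 1)) by exact: expR_gt0.
have b0 : 0 < expR (c * (x - 1)) by exact: expR_gt0.
rewrite -ln_div ?posrE ?divr_gt0 ?addr_gt0 ?expR_gt0//; congr ln.
rewrite (_ : c * (- x + 1) = - (c * (x - 1))); last by ring.
rewrite (_ : c * (- x - 1) = - (c * (x + 1))); last by ring.
rewrite !expRN.
have -> : expR (2 * c) = expR (c * (x + 1)) / expR (c * (x - 1)).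
  by rewrite -expRB; congr expR; ring.
field.
by rewrite !gt_eqF//= ?addr_gt0 ?mulr_gt0 ?addr_gt0 ?invr_gt0.
Qed.

End Primitive.

(** * The kernel [Psi]: symmetry, primitive, total mass and tails *)

Definition Psi_primitive (R : realType) (c q x : R) : R :=
  2^-1 * (G_primitive c q x + G_primitive c q^-1 x).

Section Psi_theory.
Context {R : realType}.
Variables (B q beta : R) (q_gt0 : 0 < q) (beta_gt0 : 0 < beta) (B_gt1 : 1 < B).

Let c : R := beta * ln B.
Let c_gt0 : 0 < c.
Proof. by rewrite mulr_gt0// ln_gt0. Qed.
Let qV_gt0 : 0 < q^-1.
Proof. by rewrite invr_gt0. Qed.

Lemma powR_expR_mul_ln (x : R) : B `^ (beta * x) = expR (c * x).
Proof. by rewrite /powR gt_eqF ?(lt_trans ltr01)// mulrAC. Qed.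

Lemma nuE (p x : R) : nu B p beta x = (1 + p * expR (- (c * x)))^-1.
Proof. by rewrite /nu powRN powR_expR_mul_ln expRN. Qed.

Lemma nu_le (p x y : R) : 0 < p -> x <= y -> nu B p beta x <= nu B p beta y.
Proof.
move=> p0 xy; rewrite !nuE lef_pV2 ?posrE ?addr_gt0 ?mulr_gt0 ?expR_gt0//.
by rewrite lerD2l ler_pM2l// ler_expR lerN2 ler_pM2l.
Qed.

Lemma nuN (p x : R) : 0 < p -> nu B p beta (- x) = 1 - nu B p^-1 beta x.
Proof.
move=> p0; rewrite !nuE mulrN opprK expRN.
have := expR_gt0 (c * x) => e0.
by field; rewrite !gt_eqF//= ?addr_gt0 ?mulr_gt0.
Qed.

Lemma G_ge0 (p x : R) : 0 < p -> 0 <= G B p beta x.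
Proof.
by move=> p0; rewrite mulr_ge0// subr_ge0 nu_le//; lra.
Qed.

Lemma GN (p x : R) : 0 < p -> G B p beta (- x) = G B p^-1 beta x.
Proof.
move=> p0; rewrite /G (_ : - x + 1 = - (x - 1)); last by ring.
rewrite (_ : - x - 1 = - (x + 1)); last by ring.
by rewrite !nuN//; ring.
Qed.

Lemma Psi_ge0 (x : R) : 0 <= Psi B q beta x.
Proof. by rewrite mulr_ge0// addr_ge0// G_ge0. Qed.

(** Reflection exchanges the parameters q and 1/q, and [Psi] averages over both. *)
Lemma PsiN (x : R) : Psi B q beta (- x) = Psi B q beta x.
Proof. by rewrite /Psi !GN// invrK addrC. Qed.

Lemma is_derive_G_primitive (p x : R) : 0 < p ->
  is_derive x 1 (G_primitive c p) (G B p beta x).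
Proof.
move=> p0; rewrite /G !nuE.
have shift (h : R) : is_derive x 1 (fun y => nu_primitive c p (y + h))
    (1 + p * expR (- (c * (x + h))))^-1.
  have := @is_derive1_comp _ _ (fun y => y + h) x _ _
    (is_derive_nu_primitive c_gt0 (x + h) p0)
    (is_deriveD (is_derive_id x 1) (is_derive_cst h x 1)).
  by move=> /is_derive_eq; apply; rewrite addr0 mulr1.
exact: is_deriveZ (is_deriveB (shift 1) (shift (- 1))).
Qed.

Lemma is_derive_Psi_primitive (x : R) :
  is_derive x 1 (Psi_primitive c q) (Psi B q beta x).
Proof.
exact: is_deriveZ (is_deriveD (is_derive_G_primitive x q_gt0)
  (is_derive_G_primitive x qV_gt0)).
Qed.

Lemma Psi_primitive_ge0 (x : R) : 0 <= Psi_primitive c q x.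
Proof. by rewrite mulr_ge0// addr_ge0// G_primitive_ge0. Qed.

Lemma Psi_primitive_le (x : R) :
  Psi_primitive c q x <= 2^-1 * (q + q^-1) * expR (c * (x + 1)).
Proof.
rewrite -mulrA ler_pM2l// addrC mulrDl lerD//.
  by rewrite (le_trans (G_primitive_le _ _ _))// invrK.
exact: G_primitive_le.
Qed.

Lemma Psi_primitive_onem (x : R) :
  1 - Psi_primitive c q x = Psi_primitive c q (- x).
Proof.
have := G_primitive_onem c_gt0 x q_gt0.
have := G_primitive_onem c_gt0 x qV_gt0.
by rewrite invrK /Psi_primitive => <- <-; field.
Qed.

Lemma continuous_nu (p : R) : 0 < p -> continuous (nu B p beta).
Proof.
move=> p0 x; rewrite (_ : nu B p beta = fun y => (1 + p * expR (- (c * y)))^-1).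
  apply: cvgV; first by rewrite gt_eqF// addr_gt0// mulr_gt0// expR_gt0.
  apply: cvgD; first exact: cvg_cst.
  apply: cvgM; first exact: cvg_cst.
  apply: (@continuous_comp _ _ _ (fun y => - (c * y)) expR).
    by apply: cvgN; apply: cvgM; [exact: cvg_cst|exact: cvg_id].
  exact: continuous_expR.
by apply/funext => y; exact: nuE.
Qed.

Lemma continuous_G (p : R) : 0 < p -> continuous (G B p beta).
Proof.
move=> p0 x; apply: cvgM; first exact: cvg_cst.
have shift (h : R) : {for x, continuous (fun y => nu B p beta (y + h))}.
  apply: (@continuous_comp _ _ _ (fun y => y + h) (nu B p beta)).
    by apply: cvgD; [exact: cvg_id|exact: cvg_cst].
  exact: continuous_nu.
by apply: cvgB; exact: shift.
Qed.

Lemma continuous_Psi : continuous (Psi B q beta).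
Proof.
move=> x; apply: cvgM; first exact: cvg_cst.
by apply: cvgD; exact: continuous_G.
Qed.

(** This is the boundary value at infinity for the fundamental theorem of calculus on a half-line;
    the exponential bound squeezes it to 0. *)
Lemma cvg_Psi_primitive (s : R) : Psi_primitive c q (s - v) @[v --> +oo] --> 0.
Proof.
pose K : R := 2^-1 * (q + q^-1) * expR (c * (s + 1)).
apply: (@squeeze_cvgr _ _ _ _ (fun=> 0) (fun v => K * expR (- (c * v)))).
- apply: nearW => v; rewrite Psi_primitive_ge0/= (le_trans (Psi_primitive_le _))//.
  rewrite (_ : c * (s - v + 1) = c * (s + 1) - c * v); last by ring.
  by rewrite expRD mulrA.
- exact: cvg_cst.
- rewrite -(mulr0 K); apply: cvgM; first exact: cvg_cst.
  exact: cvg_expRNM.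
Qed.

(** The function - Phi (s - v) is a primitive in v that vanishes at +oo. As the integrand is
    nonnegative, integrability need not be known beforehand. *)
Lemma integral_Psi_right (s a : R) :
  (\int[lebesgue_measure]_(v in `[a, +oo[) (Psi B q beta (s - v))%:E =
   (Psi_primitive c q (s - a))%:E)%E.
Proof.
have cs (x : R) : {for x, continuous (fun v => s - v)}.
  by apply: cvgB; [exact: cvg_cst|exact: cvg_id].
have dF (x : R) : is_derive x 1 (fun v => - Psi_primitive c q (s - v))
    (Psi B q beta (s - x)).
  have := is_deriveN (@is_derive1_comp _ _ (fun v => s - v) x _ _
    (is_derive_Psi_primitive (s - x))
    (is_deriveB (is_derive_cst s x 1) (is_derive_id x 1))).
  by move=> /is_derive_eq; apply; ring.
rewrite (@ge0_continuous_FTC2y _ _ (fun v => - Psi_primitive c q (s - v)) _ 0).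
- by rewrite -EFinB sub0r opprK.
- by move=> x _; exact: Psi_ge0.
- apply: continuous_subspaceT => x.
  exact: continuous_comp (cs x) (@continuous_Psi _).
- by rewrite -oppr0; apply: cvgN; exact: cvg_Psi_primitive.
- by move=> x _; apply: ex_derive.
- apply: cvg_at_right_filter.
  have [dFa _] := dF a.
  by move/derivable1_diffP/differentiable_continuous : dFa.
- by move=> x _; rewrite derive1E derive_val.
Qed.

(** The substitution v -> - v and the evenness of [Psi] give the right half-line from - a, with s
    replaced by - s. *)
Lemma integral_Psi_left (s a : R) :
  (\int[lebesgue_measure]_(v in `]-oo, a]) (Psi B q beta (s - v))%:E =
   (Psi_primitive c q (a - s))%:E)%E.
Proof.
rewrite -(opprK a) ge0_integration_by_substitutionNy; last 2 first.
- apply: continuous_subspaceT => x.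
  apply: (@continuous_comp _ _ _ (fun v => s - v)); last exact: continuous_Psi.
  by apply: cvgB; [exact: cvg_cst|exact: cvg_id].
- by move=> x _; exact: Psi_ge0.
under eq_integral => x _.
  rewrite /= -PsiN opprB addrC; over.
by rewrite integral_Psi_right opprK addrC.
Qed.

Lemma measurable_Psi_sub (s : R) :
  measurable_fun [set: R] (fun v => Psi B q beta (s - v)).
Proof.
apply: continuous_measurable_fun => x.
apply: (@continuous_comp _ _ _ (fun v => s - v)); last exact: continuous_Psi.
by apply: cvgB; [exact: cvg_cst|exact: cvg_id].
Qed.

(** Cutting at v = s gives two halves of mass Phi 0 each, and 1 - Phi 0 = Phi 0 by the reflection
    identity. *)
Lemma integral_Psi (s : R) :
  (\int[lebesgue_measure]_v (Psi B q beta (s - v))%:E = 1)%E.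
Proof.
have mPsi (D : set R) : measurable D ->
    measurable_fun D (EFin \o (fun v => Psi B q beta (s - v))).
  move=> mD; apply/measurable_EFinP; apply: measurable_funTS.
  exact: measurable_Psi_sub.
rewrite -(setUv `]-oo, s]%classic) ge0_integral_setU//=; last 4 first.
- exact: measurableC.
- by apply: mPsi; rewrite setUv.
- by move=> x _; rewrite lee_fin Psi_ge0.
- exact/disj_setPCl.
(* The complement is open at s; adding this null point makes the half-line formula applicable. *)
rewrite setCitvl integral_itv_obnd_cbnd; last exact: mPsi.
rewrite integral_Psi_left integral_Psi_right -EFinD; congr EFin.
have := Psi_primitive_onem 0; rewrite oppr0 subrr.
by move=> /(congr1 (fun x => x + Psi_primitive c q 0)); rewrite subrK.
Qed.

Lemma integrable_Psi (s : R) :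
  lebesgue_measure.-integrable [set: R] (fun v => (Psi B q beta (s - v))%:E).
Proof.
apply/integrableP; split.
  by apply/measurable_EFinP; exact: measurable_Psi_sub.
under eq_integral => v _ do rewrite /= ger0_norm ?Psi_ge0//.
by rewrite integral_Psi ltry.
Qed.

(** Positivity of m makes the tails disjoint; each has mass Phi (- m), bounded by half of the
    right-hand side. *)
Lemma Rintegral_Psi_tails (s m : R) : 0 < m ->
  (\int[lebesgue_measure]_(v in `]-oo, (s - m)%R] `|` `[(s + m)%R, +oo[)
    Psi B q beta (s - v))%R <= (q + q^-1) * expR (- (c * (m - 1))).
Proof.
move=> m0; rewrite Rintegral_setU//; last 2 first.
- by apply: integrableS (integrable_Psi s) => //; exact: measurableU.
- apply/disj_setPS => x /= []; rewrite !in_itv/= andbT => h1 h2.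
  by move: (le_trans h2 h1); lra.
rewrite /Rintegral integral_Psi_left integral_Psi_right/=.
rewrite (_ : s - m - s = - m); last by ring.
rewrite (_ : s - (s + m) = - m); last by ring.
apply: (le_trans (lerD (Psi_primitive_le _) (Psi_primitive_le _))).
rewrite (_ : - (c * (m - 1)) = c * (- m + 1)); last by ring.
by rewrite le_eqVlt; apply/orP; left; apply/eqP; field; rewrite gt_eqF.
Qed.

End Psi_theory.

(** * Approximation by a nonnegative kernel of mass one *)

Lemma Rintegral_kernel_dist_le d (T : measurableType d) (R : realType)
    (mu : {measure set T -> \bar R}) (W g : T -> R) (k M e : R) (D : set T) :
  measurable D -> measurable_fun [set: T] g ->
  mu.-integrable [set: T] (EFin \o W) -> (forall v, 0 <= W v) ->
  (\int[mu]_v W v)%R = 1 ->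
  0 <= e -> (forall v, `|g v - k| <= M) -> (forall v, ~ D v -> `|g v - k| <= e) ->
  `|(\int[mu]_v (g v * W v))%R - k| <= e + M * (\int[mu]_(v in D) W v)%R.
Proof.
move=> mD mg iW W0 W1 e0 gM ge.
have M0 (v : T) : 0 <= M := le_trans (normr_ge0 _) (gM v).
have mgk : measurable_fun setT (fun v => g v - k).
  by apply: measurable_funB => //; exact: measurable_cst.
have igkW : mu.-integrable setT (EFin \o (fun v => (g v - k) * W v)).
  apply: (@integrableMr _ _ _ mu setT measurableT (fun v => g v - k) (EFin \o W)) => //.
  exists M; split; first exact: num_real.
  by move=> x Mx v _; exact: le_trans (gM v) (ltW Mx).
have iZ (r : R) (h : T -> R) : mu.-integrable setT (EFin \o h) ->
    mu.-integrable setT (EFin \o (fun v => r * h v)).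
  move=> ih; apply: eq_integrable (integrableZl measurableT r ih) => //.
have ikW := iZ k _ iW.
have ieW := iZ e _ iW.
(* Extending W by 0 outside D turns the tail integral into one over the whole space, so a single
   pointwise comparison suffices. *)
have iWD : mu.-integrable setT (EFin \o (W \_ D)).
  have iD : mu.-integrable D (EFin \o W) by exact: integrableS iW.
  by rewrite -restrict_EFin; apply/(integrable_mkcond _ mD).
(* Mass one lets k be written as the integral of k W. *)
have -> : (\int[mu]_v (g v * W v))%R - k = (\int[mu]_v ((g v - k) * W v))%R.
  rewrite -{1}(mulr1 k) -W1 -RintegralZl// -RintegralB//.
    by apply: eq_Rintegral => v _; ring.
  apply: eq_integrable (integrableD _ igkW ikW) => // v _.
  by rewrite /= -EFinD; congr EFin; ring.
have iMW := iZ M _ iWD.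
apply: (le_trans (le_normr_Rintegral _ _)) => //.
(* The right-hand side becomes the integral of e W + M (W \_ D), which dominates |g - k| W: by M <=
   e + M on D, by e elsewhere. *)
rewrite -[X in X + _]mulr1 -W1 (Rintegral_mkcond _ D) -!RintegralZl// -RintegralD//.
apply: le_Rintegral => //.
- exact: (integrable_norm igkW).
- exact: (integrableD measurableT ieW iMW).
move=> v _; rewrite normrM (ger0_norm (W0 v)) patchE; case: ifPn => vD.
  by rewrite -mulrDl ler_wpM2r// (le_trans (gM v))// lerDr.
by rewrite mulr0 addr0 ler_wpM2r// ge// => /mem_set; exact/negP.
Qed.

(** The radius d and the oscillation bound e are kept free: the quantitative estimate takes d =
    n^(-alpha), uniform convergence a fixed d. In the variable v the centre is s = n x and the
    radius m = n d. *)
Lemma A_dist_le (R : realType) (q beta B : R) (f : R -> R) (n : nat)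
    (x d e M : R) :
  0 < q -> 0 < beta -> 1 < B -> (0 < n)%N -> 0 < d -> 0 <= e ->
  continuous f -> (forall y, `|f y| <= M) ->
  (forall y, `|x - y| <= d -> `|f x - f y| <= e) ->
  `|A B q beta n f x - f x| <=
    e + 2 * (q + q^-1) * M * (B `^ (beta * (n%:R * d - 1)))^-1.
Proof.
move=> q0 beta0 B1 n0 d0 e0 cf fM fe.
have nR0 : 0 < n%:R :> R by rewrite ltr0n.
set s := n%:R * x; set m := n%:R * d.
have m0 : 0 < m by rewrite mulr_gt0.
have := @Rintegral_kernel_dist_le _ _ R lebesgue_measure
  (fun v => Psi B q beta (s - v)) (fun v => f (v / n%:R)) (f x) (2 * M) e
  (`]-oo, (s - m)%R] `|` `[(s + m)%R, +oo[).
have cg : continuous (fun v : R => f (v / n%:R)).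
  move=> v; apply: (@continuous_comp _ _ _ (fun v : R => v / n%:R) f); last exact: cf.
  by apply: cvgM; [exact: cvg_id|exact: cvg_cst].
have -> : (\int[lebesgue_measure]_v (f (v / n%:R) * Psi B q beta (s - v)))%R =
  A B q beta n f x by [].
move=> H; apply: le_trans (H _ _ _ _ _ _ _ _) _ => {H}//.
- exact: measurableU.
- exact: continuous_measurable_fun.
- exact: integrable_Psi.
- by move=> v; exact: Psi_ge0.
- by rewrite /Rintegral integral_Psi.
- move=> v; rewrite mulr2n mulrDl mul1r (le_trans (ler_normB _ _))// lerD//.
(* Off the tails |s - v| < n d, hence |x - v / n| <= d after division by n. *)
- move=> v /not_orP[]; rewrite /= !in_itv/= andbT => /negP + /negP.
  rewrite -!ltNge => h1 h2; rewrite distrC; apply: fe.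
  have -> : x - v / n%:R = n%:R^-1 * (s - v) by rewrite /s; field; rewrite gt_eqF.
  rewrite normrM gtr0_norm ?invr_gt0// mulrC ler_pdivrMr// mulrC -/m.
  by rewrite ler_norml; lra.
rewrite lerD2l.
have M0 : 0 <= 2 * M by rewrite mulr_ge0// (le_trans (normr_ge0 _) (fM 0)).
apply: (le_trans (ler_wpM2l M0 (Rintegral_Psi_tails q0 beta0 B1 s m0))).
by rewrite powR_expR_mul_ln// expRN le_eqVlt; apply/orP; left; apply/eqP; ring.
Qed.

(** * Finite suprema, uniform convergence and the final estimates *)

Lemma ereal_sup_EFin_bounded (T : Type) (R : realType) (S : set T)
    (h : T -> R) (K : R) (i0 : T) :
  S i0 -> (forall i, S i -> h i <= K) ->
  exists r : R, ereal_sup [set (h i)%:E | i in S] = r%:E /\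
    forall i, S i -> h i <= r.
Proof.
move=> Si0 hK.
have le_sup i : S i -> ((h i)%:E <= ereal_sup [set (h i)%:E | i in S])%E.
  by move=> Si; apply: ereal_sup_ubound; exists i.
(* The point [i0] excludes the value -oo and the bound K excludes +oo. *)
have : ereal_sup [set (h i)%:E | i in S] \is a fin_num.
  rewrite fin_real// (lt_le_trans (ltNyr _) (le_sup _ Si0))/=.
  apply: (@le_lt_trans _ _ K%:E); last exact: ltry.
  by apply: ge_ereal_sup => _ [i Si <-]; rewrite lee_fin hK.
move=> /fineK supE; exists (fine (ereal_sup [set (h i)%:E | i in S])).
by split=> [//|i Si]; rewrite -lee_fin supE le_sup.
Qed.

Lemma bounded_fun_normr_le (R : realType) (f : R -> R) :
  bounded_fun f -> exists M, forall y, `|f y| <= M.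
Proof.
(* [bounded_fun] only provides bounds strictly above M, hence the choice M + 1. *)
by move=> [M [_ fM]]; exists (M + 1) => y; apply: fM => //; rewrite ltrDl.
Qed.

Lemma A_unif_cvg (R : realType) (q beta B : R) (f : R -> R) (e : R) :
  0 < q -> 0 < beta -> 1 < B -> CUB f -> 0 < e ->
  \forall n \near \oo, forall x, `|f x - A B q beta n f x| < e.
Proof.
move=> q0 beta0 B1 [uf bf] e0.
have [M fM] := bounded_fun_normr_le bf.
have e20 : 0 < e / 2 by rewrite divr_gt0.
have /unif_continuousP /(_ _ e20) [d /= d0 fd] := uf.
have d20 : 0 < d / 2 by rewrite divr_gt0.
(* Halving d places the closed condition inside the open ball given by uniform continuity. *)
have close x y : `|x - y| <= d / 2 -> `|f x - f y| <= e / 2.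
  move=> xy; apply/ltW; have := fd (x, y); rewrite /= -!ball_normE/=; apply.
  by rewrite (le_lt_trans xy)//; lra.
have cf : continuous f.
  move=> x; apply/cvgrPdist_le => eps eps0.
  have /unif_continuousP /(_ _ eps0) [d' /= d'0 fd'] := uf.
  near=> y; apply/ltW.
  have := fd' (x, y); rewrite /= -!ball_normE/=; apply.
  near: y; exact: (@cvgr_dist_lt _ _ _ _ _ id x cvg_id).
pose K : R := 2 * (q + q^-1) * M.
have tail : K * (B `^ (beta * (n%:R * (d / 2) - 1)))^-1 @[n --> \oo] --> 0.
  pose b : R := beta * ln B.
  have b0 : 0 < b by rewrite mulr_gt0// ln_gt0.
  (* The shift by - 1 in the exponent contributes the constant e^b, leaving a pure exponential decay
     in n. *)
  rewrite (_ : (fun n => _) =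
      (fun n : nat => K * expR b * expR (- (b * (d / 2) * n%:R)))); last first.
    apply/funext => n; rewrite powR_expR_mul_ln// -expRN -(mulrA K) -expRD.
    by congr (_ * expR _); rewrite /b; ring.
  rewrite -(mulr0 (K * expR b)); apply: cvgM; first exact: cvg_cst.
  apply: (@cvg_comp _ _ _ (fun n : nat => n%:R : R)
    (fun x : R => expR (- (b * (d / 2) * x))) \oo +oo); first exact: cvgr_idn.
  by apply: cvg_expRNM; rewrite mulr_gt0.
near=> n; move=> x; rewrite distrC.
have n0 : (0 < n)%N by near: n; exact: nbhs_infty_gt.
apply: (le_lt_trans (A_dist_le q0 beta0 B1 n0 d20 (ltW e20) cf fM (close x))).
rewrite -/K [ltRHS]splitr ltrD2l.
near: n; exact: (cvgr_lt _ tail).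
Unshelve. all: by end_near. Qed.

Theorem theorem2 (R : realType) (q beta B : R)
    (hq : 0 < q) (hbeta : 0 < beta) (hB : 1 < B) :
  (forall (alpha : R) (n : nat) (f : R -> R),
     0 < alpha -> alpha < 1 ->
     (0 < n)%N -> 2 < n%:R `^ (1 - alpha) ->
     CB f ->
     let T : \bar R :=
       (omega f (1 / n%:R `^ alpha)%R
        + (2 * (q + 1 / q))%R%:E * supnorm f
          * ((B `^ (beta * (n%:R `^ (1 - alpha) - 1)))^-1)%R%:E)%E in
     (forall x : R, (`|A B q beta n f x - f x|%R%:E <= T)%E)
     /\ (supnorm (fun x => A B q beta n f x - f x)%R <= T)%E)
  /\
  (forall f : R -> R, CUB f ->
     (forall x : R, A B q beta n f x @[n --> \oo] --> f x)
     /\ {uniform, A B q beta n f @[n --> \oo] --> f}).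
Proof.
split=> [alpha n f _ _ n0 _ [cf bf] T|f cubf]; last first.
  have unif e : 0 < e -> \forall n \near \oo, forall x, `|f x - A B q beta n f x| < e.
    exact: A_unif_cvg.
  split=> [x|].
    by apply/cvgrPdist_lt => e e0; near=> n; near: n; apply: filterS (unif e e0).
  (* A neighbourhood of f for uniform convergence contains all functions within some distance e of f
     everywhere. *)
  move=> P /uniform_nbhs[E [+ EP]]; rewrite -entourage_ballE => -[e /= e0 eE].
  apply: filterS (unif e e0) => n Hn; apply: EP => y _; apply: eE.
  by rewrite /= -ball_normE/=; exact: Hn.
(* T does not depend on x, so the pointwise bound passes to the supremum. *)
suff ATx x : (`|A B q beta n f x - f x|%R%:E <= T)%E.
  by split=> //; apply: ge_ereal_sup => _ [x _ <-].
have [K fK] := bounded_fun_normr_le bf.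
have [M [supE fM]] := @ereal_sup_EFin_bounded _ _ setT (fun x => `|f x|) K 0 I
  (fun x _ => fK x).
have nR0 : 0 < n%:R :> R by rewrite ltr0n.
pose d := 1 / n%:R `^ alpha.
have d0 : 0 < d by rewrite divr_gt0// powR_gt0.
(* The modulus is finite, being at most 2 K; the pair (0, 0) shows that its index set is
   nonempty. *)
have [||w [wE fw]] := @ereal_sup_EFin_bounded _ _
  [set z : R * R | `|z.1 - z.2| <= d] (fun z => `|f z.1 - f z.2|) (K + K) (0, 0).
- by rewrite /= subrr normr0 ltW.
- by move=> z _; rewrite (le_trans (ler_normB _ _))// lerD.
rewrite /T /supnorm supE /omega wE -!EFinM -EFinD lee_fin div1r.
(* This matches the exponent in T with the product n d of the general estimate. *)
have -> : n%:R `^ (1 - alpha) = n%:R * d.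
  rewrite powRD ?(gt_eqF nR0) ?implybT// powRr1 ?ltW// powRN /d div1r//.
apply: A_dist_le => //.
- by apply: le_trans (fw (0, 0) _); rewrite /= subrr normr0// ltW.
- by move=> y; exact: fM.
- by move=> y xy; exact: (fw (x, y)).
Unshelve. all: by end_near. Qed.
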